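(* Let $I$ be a set of sorts and for each $i\in I$ let $(\mathcal{M}(i),R(i),\mathcal{Y}(i),\mathcal{O}(i),T_1(S)(i))$ be a framework (as defined in the context). Let $V=\bigcup_{i,j\in I}V(i,j)$ be a family of maps such that every $v\in V(i,j)$ is an advanceable continuous homomorphism $\overline{\mathcal{M}}(j)\to\overline{\mathcal{M}}(i)$. For each $i\in I$, let $P(i)$ be a partial order on $\mathcal{Y}(i)$ with which $T_1(S)(i)$ is compatible. If every $v\in V(i,j)$, for all $i,j\in I$, correlates $P(j)$ to $P(i)$, then the following claims are equivalent: (a') Every ambiguity of $T_1(S)(i)$ is resolvable relative to $P(i)$, for all $i\in I$. (a'') Every $V$-critical ambiguity of $T_1(S)(i)$ is resolvable relative to $P(i)$, for all $i\in I$.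
   Context: Framework of sort $i$. $\mathcal{M}(i)$ is an abelian group (written additively); $R(i)$ is a set of group endomorphisms of $\mathcal{M}(i)$. A subgroup $N$ is called an $R(i)$-module if $r(a)\in N$ for all $a\in N$, $r\in R(i)$. $\mathcal{Y}(i)\subseteq\mathcal{M}(i)$ is such that the only $R(i)$-module $N\subseteq\mathcal{M}(i)$ with $\mathcal{Y}(i)\subseteq N$ is $\mathcal{M}(i)$. $\mathcal{O}(i)=\{B_n(i)\}_{n=1}^\infty$ is a family of $R(i)$-modules in $\mathcal{M}(i)$ with $B_n(i)\supseteq B_{n+1}(i)$ and $\bigcap_nB_n(i)=\{0\}$. $\mathcal{M}(i)$ carries the group topology for which $\mathcal{O}(i)$ is a fundamental system of neighbourhoods of $0$; $\overline{\mathcal{M}}(i)\supseteq\mathcal{M}(i)$ is its completion. Group operations and elements of $R(i)$ are extended to $\overline{\mathcal{M}}(i)$ by continuity. $\mathrm{Span}(Z)$ is the smallest $R(i)$-module containing $Z\subseteq\overline{\mathcal{M}}(i)$, and $\mathrm{Cspan}(Z)$ is its closure in $\overline{\mathcal{M}}(i)$. $R^*(i)$ is the set of all finite compositions of elements of $R(i)$, including the identity; $R^*\mathcal{Y}(i)=\{r(\mu):r\in R^*(i),\mu\in\mathcal{Y}(i)\}$. $T_1(S)(i)$ is a set of continuous group homomorphisms $\overline{\mathcal{M}}(i)\to\overline{\mathcal{M}}(i)$ commuting with all elements of $R(i)$ ($S$ is just a label); $T(S)(i)$ is the set of all finite compositions of elements of $T_1(S)(i)$, including the identity. A map $t$ acts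 nontrivially on $a$ if $t(a)\ne a$. Orders. ''$\nu<\mu$ in $P(i)$'' is the strict relation. $\mathrm{DSM}(\mu,P(i))=\mathrm{Cspan}(\{\nu\in\mathcal{Y}(i):\nu<\mu\text{ in }P(i)\})$. $T_1(S)(i)$ is compatible with $P(i)$ if $t(\mu)\in\{\mu\}\cup\mathrm{DSM}(\mu,P(i))$ for all $t\in T_1(S)(i)$, $\mu\in\mathcal{Y}(i)$. $\mathrm{DIS}(\mu,P(i),S)=\mathrm{Cspan}(\{\nu-t(\nu):\nu\in\mathcal{Y}(i),\nu<\mu\text{ in }P(i),t\in T_1(S)(i)\})$. A map $v:\overline{\mathcal{M}}(j)\to\overline{\mathcal{M}}(i)$ correlates $P(j)$ to $P(i)$ if for all $\mu\in\mathcal{Y}(j)$ with $v(\mu)\in\mathcal{Y}(i)$ one has $v(\mathrm{DSM}(\mu,P(j)))\subseteq\mathrm{DSM}(v(\mu),P(i))$. Ambiguities. An ambiguity of $T_1(S)(i)$ is a triplet $(t,\mu,u)$ with $t,u\in T_1(S)(i)$ both acting nontrivially on $\mu\in\mathcal{Y}(i)$; $(t,\mu,u)$ and $(u,\mu,t)$ are considered equivalent. It is resolvable relative to $P(i)$ if $t(\mu)-u(\mu)\in\mathrm{DIS}(\mu,P(i),S)$. Advanceability. $v:\overline{\mathcal{M}}(j)\to\overline{\mathcal{M}}(i)$ is advanceable if for every $t'\in T_1(S)(j)$ and $a\in R^*\mathcal{Y}(j)$ there exists $t\in T(S)(i)$ with $t(v(a))=v(t'(a))$. A bihomomorphism (additive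 in each argument) $w:\overline{\mathcal{M}}(i_1)\times\overline{\mathcal{M}}(i_2)\to\overline{\mathcal{M}}(i)$ is biadvanceable if for all $b_1\in R^*\mathcal{Y}(i_1)$, $b_2\in R^*\mathcal{Y}(i_2)$: for every $t_1\in T_1(S)(i_1)$ there is $t\in T(S)(i)$ with $t(w(b_1,b_2))=w(t_1(b_1),b_2)$, and for every $t_2\in T(S)(i_2)$ there is $t\in T(S)(i)$ with $t(w(b_1,b_2))=w(b_1,t_2(b_2))$. Given a set $V_1$ of maps $\overline{\mathcal{M}}(i_1)\to\overline{\mathcal{M}}(i)$ and a set $V_2$ of maps $\overline{\mathcal{M}}(i_2)\to\overline{\mathcal{M}}(i)$, a biadvanceable $w$ is $(V_1,V_2)$-biadvanceable if $w(\cdot,\rho)\in V_1$ for all $\rho\in\mathcal{Y}(i_2)$ and $w(\rho,\cdot)\in V_2$ for all $\rho\in\mathcal{Y}(i_1)$. An ambiguity $(t,\mu,u)$ of $T_1(S)(i)$ is a $(V_1,V_2)$-montage ambiguity if there exist $(\lambda,t')\in\mathcal{Y}(i_1)\times T(S)(i_1)$, $(\nu,u')\in\mathcal{Y}(i_2)\times T(S)(i_2)$ and a continuous $(V_1,V_2)$-biadvanceable map $w:\overline{\mathcal{M}}(i_1)\times\overline{\mathcal{M}}(i_2)\to\overline{\mathcal{M}}(i)$ such that $\mu=w(\lambda,\nu)$, $t(w(\lambda,\nu))=w(t'(\lambda),\nu)$ and $u(w(\lambda,\nu))=w(\lambda,u'(\nu))$. Criticality. An ambiguity $(t,\mu,u)$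 of $T_1(S)(i)$ is a $V$-shadow of the ambiguity $(t',\mu',u')$ of $T_1(S)(i')$ if there is $v\in V(i,i')$ with $\mu=v(\mu')$, $t(\mu)=v(t'(\mu'))$, $u(\mu)=v(u'(\mu'))$. It is a proper $V$-shadow if in addition $(t',\mu',u')$ is not a $V$-shadow of $(t,\mu,u)$. An ambiguity is $V$-shadow-minimal if it is not a proper $V$-shadow of any ambiguity (of any sort). It is $V$-shadow-critical if it is not a proper $V$-shadow of any $V$-shadow-minimal ambiguity. An ambiguity of $T_1(S)(i)$ is $V$-critical if it is $V$-shadow-critical and is not a $(V(i,i_1),V(i,i_2))$-montage ambiguity for any $i_1,i_2\in I$. *)

(* Defs.v *)
From HB Require Import structures.
From mathcomp Require Import all_boot all_order all_algebra.
From mathcomp Require Import all_classical topology tvs.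

Set Implicit Arguments.
Unset Strict Implicit.
Unset Printing Implicit Defensive.

Import GRing.Theory.

Local Open Scope classical_set_scope.
Local Open Scope ring_scope.

Definition subgroup (G : zmodType) (N : set G) : Prop :=
  N 0 /\ forall a b, N a -> N b -> N (a - b).

Definition is_Rmodule (G : zmodType) (R : set (G -> G)) (N : set G) : Prop :=
  subgroup N /\ forall r a, R r -> N a -> N (r a).

(* All finite compositions of elements of A, the empty one being the identity. *)
Inductive compositions (T : Type) (A : set (T -> T)) : (T -> T) -> Prop :=
| compositions_id : compositions A idfun
| compositions_comp f g : A f -> compositions A g -> compositions A (f \o g).

(* [is_completion B iota] : [Mbar] is the completion of the abelian group [M]
   with the group topology for which [B] is a fundamental system of
   neighbourhoods of 0, [iota] being the inclusion of M.  The completion is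
   determined up to a unique isomorphism by these properties.  In a
   UniformZmodule the uniformity is necessarily the one induced by the group
   topology, so [cauchy] is the usual notion.  Since both topologies are
   translation invariant, comparing neighbourhoods of 0 suffices in the last
   condition, which says that [iota] is a topological embedding. *)
Record is_completion (M : zmodType) (B : nat -> set M)
    (Mbar : UniformZmodule.type) (iota : M -> Mbar) : Prop := IsCompletion {
  completion_additive : zmod_morphism iota;
  completion_hausdorff : hausdorff_space Mbar;
  completion_complete : forall F : set_system Mbar,
    ProperFilter F -> cauchy F -> exists x : Mbar, F --> x;
  completion_dense : dense (range iota);
  completion_embedding : forall A : set M,
    (exists n, B n `<=` A) <->
    (exists2 U, nbhs (0 : Mbar) U & iota @^-1` U `<=` A)
}.

(* The extensions by continuity to [Mbar] of the elements of [R].  When [Mbar]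
   is the completion of [M] and [r] is an endomorphism mapping each [B n] to
   itself, there is exactly one such [f]. *)
Definition extensions (M : zmodType) (Mbar : UniformZmodule.type)
    (iota : M -> Mbar) (R : set (M -> M)) : set (Mbar -> Mbar) :=
  [set f | continuous f /\ exists2 r, R r & forall a, f (iota a) = iota (r a)].

(* The family [B] is indexed from 0 rather than from 1. *)
Record framework := Framework {
  M : zmodType;
  R : set (M -> M);
  Y : set M;
  B : nat -> set M;
  Mbar : UniformZmodule.type;
  iota : M -> Mbar;
  T1 : set (Mbar -> Mbar);
  R_additive : forall r, R r -> zmod_morphism r;
  Y_generates : forall N, is_Rmodule R N -> Y `<=` N -> N = [set: M];
  B_module : forall n, is_Rmodule R (B n);
  B_decreasing : forall n, B n.+1 `<=` B n;
  B_separated : \bigcap_n B n = [set 0];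
  Mbar_completion : is_completion B iota;
  T1_additive : forall t, T1 t -> zmod_morphism t;
  T1_continuous : forall t, T1 t -> continuous t;
  T1_commute : forall t r, T1 t -> extensions iota R r -> t \o r = r \o t
}.

Arguments R : clear implicits.
Arguments Y : clear implicits.
Arguments B : clear implicits.
Arguments iota : clear implicits.
Arguments T1 : clear implicits.

Definition Rbar (F : framework) : set (Mbar F -> Mbar F) :=
  extensions (iota F) (R F).

Definition TS (F : framework) : set (Mbar F -> Mbar F) := compositions (T1 F).

Definition RstarY (F : framework) : set (Mbar F) :=
  iota F @` [set r m | r in compositions (R F) & m in Y F].

Definition Span (F : framework) (Z : set (Mbar F)) : set (Mbar F) :=
  smallest (is_Rmodule (@Rbar F)) Z.

Definition Cspan (F : framework) (Z : set (Mbar F)) : set (Mbar F) :=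
  closure (Span Z).

Section Orders.
Variable F : framework.

(* An order on Y is given by its non-strict relation; only the values on
   Y x Y matter. *)
Definition partial_order_on_Y (P : M F -> M F -> Prop) : Prop :=
  [/\ forall a, Y F a -> P a a,
      forall a b, Y F a -> Y F b -> P a b -> P b a -> a = b
    & forall a b c, Y F a -> Y F b -> Y F c -> P a b -> P b c -> P a c].

Definition strict (P : M F -> M F -> Prop) (a b : M F) : Prop :=
  P a b /\ a <> b.

Variable P : M F -> M F -> Prop.

Definition DSM (m : M F) : set (Mbar F) :=
  Cspan [set iota F n | n in [set n | Y F n /\ strict P n m]].

Definition compatible : Prop :=
  forall t m, T1 F t -> Y F m ->
    t (iota F m) = iota F m \/ DSM m (t (iota F m)).

Definition DIS (m : M F) : set (Mbar F) :=
  Cspan [set iota F n - t (iota F n)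
        | n in [set n | Y F n /\ strict P n m] & t in T1 F].

End Orders.

Section Maps.
Variables Fj Fi : framework.

Definition correlates (Pj : M Fj -> M Fj -> Prop) (Pi : M Fi -> M Fi -> Prop)
    (v : Mbar Fj -> Mbar Fi) : Prop :=
  forall m n, Y Fj m -> Y Fi n -> v (iota Fj m) = iota Fi n ->
    v @` DSM Pj m `<=` DSM Pi n.

Definition advanceable (v : Mbar Fj -> Mbar Fi) : Prop :=
  forall t' a, T1 Fj t' -> RstarY a ->
    exists2 t, TS t & t (v a) = v (t' a).

End Maps.

Section Bimaps.
Variables F1 F2 F : framework.

Definition bihomomorphism (w : Mbar F1 * Mbar F2 -> Mbar F) : Prop :=
  (forall b2, zmod_morphism (fun b1 => w (b1, b2))) /\
  (forall b1, zmod_morphism (fun b2 => w (b1, b2))).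

(* Asymmetric by definition: t1 ranges over T1, but t2 over all of T(S). *)
Definition biadvanceable (w : Mbar F1 * Mbar F2 -> Mbar F) : Prop :=
  bihomomorphism w /\
  forall b1 b2, RstarY b1 -> RstarY b2 ->
    (forall t1, T1 F1 t1 ->
       exists2 t, TS t & t (w (b1, b2)) = w (t1 b1, b2)) /\
    (forall t2, TS t2 ->
       exists2 t, TS t & t (w (b1, b2)) = w (b1, t2 b2)).

Definition biadvanceable_wrt (V1 : set (Mbar F1 -> Mbar F))
    (V2 : set (Mbar F2 -> Mbar F)) (w : Mbar F1 * Mbar F2 -> Mbar F) : Prop :=
  [/\ biadvanceable w,
      forall n, Y F2 n -> V1 (fun b1 => w (b1, iota F2 n))
    & forall n, Y F1 n -> V2 (fun b2 => w (iota F1 n, b2))].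

End Bimaps.

Record ambiguity (F : framework) := Ambiguity {
  amb_left : Mbar F -> Mbar F;
  amb_site : M F;
  amb_right : Mbar F -> Mbar F;
  amb_left_T1 : T1 F amb_left;
  amb_right_T1 : T1 F amb_right;
  amb_site_Y : Y F amb_site;
  amb_left_nontrivial : amb_left (iota F amb_site) <> iota F amb_site;
  amb_right_nontrivial : amb_right (iota F amb_site) <> iota F amb_site
}.

Definition amb_swap (F : framework) (a : ambiguity F) : ambiguity F :=
  Ambiguity (amb_right_T1 a) (amb_left_T1 a) (amb_site_Y a)
    (@amb_right_nontrivial F a) (@amb_left_nontrivial F a).

Definition amb_equiv (F : framework) (a b : ambiguity F) : Prop :=
  b = a \/ b = amb_swap a.

Definition resolvable (F : framework) (P : M F -> M F -> Prop)
    (a : ambiguity F) : Prop :=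
  DIS P (amb_site a)
    (amb_left a (iota F (amb_site a)) - amb_right a (iota F (amb_site a))).

(* [montage_triple] and [shadow_triple] are conditions on triples (t, m, u).
   As (t, m, u) and (u, m, t) stand for the same ambiguity, an ambiguity is a
   montage, or a shadow of another one, when suitable representatives are. *)
Definition montage_triple (F1 F2 F : framework) (V1 : set (Mbar F1 -> Mbar F))
    (V2 : set (Mbar F2 -> Mbar F)) (a : ambiguity F) : Prop :=
  exists (l : M F1) (t' : Mbar F1 -> Mbar F1) (n : M F2)
         (u' : Mbar F2 -> Mbar F2) (w : Mbar F1 * Mbar F2 -> Mbar F),
    [/\ Y F1 l /\ TS t', Y F2 n /\ TS u',
        continuous w /\ biadvanceable_wrt V1 V2 w,
        iota F (amb_site a) = w (iota F1 l, iota F2 n)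
      & amb_left a (w (iota F1 l, iota F2 n)) = w (t' (iota F1 l), iota F2 n) /\
        amb_right a (w (iota F1 l, iota F2 n)) = w (iota F1 l, u' (iota F2 n))].

Definition montage (F1 F2 F : framework) (V1 : set (Mbar F1 -> Mbar F))
    (V2 : set (Mbar F2 -> Mbar F)) (a : ambiguity F) : Prop :=
  exists2 a0, amb_equiv a a0 & montage_triple V1 V2 a0.

Section Criticality.
Variables (I : Type) (F : I -> framework).
Variable V : forall i j : I, set (Mbar (F j) -> Mbar (F i)).

Definition shadow_triple i i' (a : ambiguity (F i)) (a' : ambiguity (F i')) :
    Prop :=
  exists2 v, V v &
    [/\ iota (F i) (amb_site a) = v (iota (F i') (amb_site a')),
        amb_left a (iota (F i) (amb_site a)) =
          v (amb_left a' (iota (F i') (amb_site a')))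
      & amb_right a (iota (F i) (amb_site a)) =
          v (amb_right a' (iota (F i') (amb_site a')))].

Definition shadow i i' (a : ambiguity (F i)) (a' : ambiguity (F i')) : Prop :=
  exists a0 a0',
    [/\ amb_equiv a a0, amb_equiv a' a0' & shadow_triple a0 a0'].

Definition proper_shadow i i' (a : ambiguity (F i)) (a' : ambiguity (F i')) :
    Prop :=
  shadow a a' /\ ~ shadow a' a.

Definition shadow_minimal i (a : ambiguity (F i)) : Prop :=
  forall i' (a' : ambiguity (F i')), ~ proper_shadow a a'.

Definition shadow_critical i (a : ambiguity (F i)) : Prop :=
  forall i' (a' : ambiguity (F i')), shadow_minimal a' -> ~ proper_shadow a a'.

Definition critical i (a : ambiguity (F i)) : Prop :=
  shadow_critical a /\
  forall i1 i2, ~ montage (@V i i1) (@V i i2) a.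

End Criticality.

(* Main.v *)
(* A proper shadow of a shadow-minimal ambiguity is resolvable as soon as the
   latter is, and shadow-minimal ambiguities are shadow-critical, so everything
   reduces to two facts, for which the key remark is that b - t(b) lies in
   DIS(m) for all b in DSM(m) and t in T(S).
   - A map v in V sends DIS(m) to DIS(v(m)): by advanceability
     v(b - t(b)) = v(b) - s(v(b)) with s in T(S), for b in R^*Y, and
     correlation puts v(b) in DSM(v(m)).
   - Montage ambiguities are resolvable: modulo DIS(w(x, y)), the elements
     t(w(x, y)) = w(t'(x), y), w(t'(x), u'(y)) and w(x, u'(y)) = u(w(x, y))
     are congruent. *)

Require Import Defs.
From mathcomp Require Import all_boot all_order all_algebra.
From mathcomp Require Import all_classical topology tvs.

Import GRing.Theory.
(* Restores [Defs.iota], hidden by [seq.iota]. *)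
Import Defs.

Local Open Scope classical_set_scope.
Local Open Scope ring_scope.

(** * Closed subgroups and continuous additive maps *)

Lemma unif_continuous_continuous (U V : uniformType) (f : U -> V) :
  unif_continuous f -> continuous f.
Proof.
move=> uf x; apply/cvg_entourageP => A entA; apply/nbhsP.
exists [set xy | A (f xy.1, f xy.2)]; first exact: uf.
by move=> y /xsectionP.
Qed.

Lemma continuous_sub (T : topologicalType) (G : UniformZmodule.type)
    (f g : T -> G) :
  continuous f -> continuous g -> continuous (fun x => f x - g x).
Proof.
move=> cf cg x.
apply: (@continuous2_cvg _ _ _ _ _ _ f g (fun a b => a - b));
  [|exact: cf|exact: cg].
exact: (unif_continuous_continuous _ _ _ (@sub_unif_continuous G) (f x, g x)).
Qed.

Lemma zmod_morphism0 (G H : zmodType) (f : G -> H) :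
  zmod_morphism f -> f 0 = 0.
Proof. by move=> fB; rewrite -(subr0 0) fB subrr. Qed.

Lemma subgroup_opp (G : zmodType) (N : set G) a : subgroup N -> N a -> N (- a).
Proof. by move=> [N0 NB] Na; rewrite -sub0r; apply: NB. Qed.

Lemma subgroup_add (G : zmodType) (N : set G) a b :
  subgroup N -> N a -> N b -> N (a + b).
Proof.
by move=> sN Na Nb; rewrite -(opprK b); apply: sN.2 => //; apply: subgroup_opp.
Qed.

(** Together with [closed_preimage_diff], this allows a congruence between two continuous additive
    maps modulo a closed subgroup to be checked on generators. *)
Lemma subgroup_preimage_diff (G H : zmodType) (f g : G -> H) (N : set H) :
  zmod_morphism f -> zmod_morphism g -> subgroup N ->
  subgroup [set x | N (f x - g x)].
Proof.
move=> fB gB [N0 NB]; split=> [|a b /= Na Nb] /=.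
  by rewrite (zmod_morphism0 _ _ _ fB) (zmod_morphism0 _ _ _ gB) subrr.
rewrite fB gB; have -> : f a - f b - (g a - g b) = f a - g a - (f b - g b).
  by rewrite !opprB addrACA [RHS]addrACA; congr (_ + _); rewrite addrC.
exact: NB.
Qed.

Lemma subgroup_preimage (G H : zmodType) (f : G -> H) (N : set H) :
  zmod_morphism f -> subgroup N -> subgroup (f @^-1` N).
Proof.
move=> fB [N0 NB]; split=> [|a b Na Nb] /=.
  by rewrite (zmod_morphism0 _ _ _ fB).
by rewrite fB; apply: NB.
Qed.

Lemma closed_preimage (T U : topologicalType) (f : T -> U) (A : set U) :
  continuous f -> closed A -> closed (f @^-1` A).
Proof. by move=> /continuous_closedP; apply. Qed.

Lemma closed_preimage_diff (T : topologicalType) (G : UniformZmodule.type)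
    (f g : T -> G) (A : set G) :
  continuous f -> continuous g -> closed A -> closed [set x | A (f x - g x)].
Proof.
by move=> cf cg; apply: (closed_preimage _ _ (fun x => f x - g x));
  apply: continuous_sub.
Qed.

Lemma closed_dense_setT (T : topologicalType) (A D : set T) :
  dense D -> closed A -> D `<=` A -> forall x, A x.
Proof.
move=> dD cA DA x; apply: contrapT => nAx.
have [||y [/= nAy /DA//]] := dD (~` A); first by exists x.
exact: closed_openC.
Qed.

Lemma closure_subgroup (G : UniformZmodule.type) (N : set G) :
  subgroup N -> subgroup (closure N).
Proof.
move=> [N0 NB]; split=> [|a b]; first exact: subset_closure.
(* Limits are taken one variable at a time: first in the left argument with [y] in [N], then in the
   right one with [a] in the closure. *)
suff H1 : forall y, N y -> closure N `<=` [set x | closure N (x - y)].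
  have cl x : closed [set y | closure N (x - y)].
    apply: closed_preimage_diff; last exact: closed_closure.
      by move=> ?; apply: cvg_cst.
    by move=> ?; apply: cvg_id.
  move=> Na; move: b; change (closure N `<=` [set y | closure N (a - y)]).
  rewrite [X in _ `<=` X](closure_id _).1 //.
  by apply: closureS => y Ny; apply: H1.
move=> y Ny; rewrite [X in _ `<=` X](closure_id _).1; last first.
  apply: closed_preimage_diff; last exact: closed_closure.
    by move=> ?; apply: cvg_id.
  by move=> ?; apply: cvg_cst.
by apply: closureS => x Nx /=; apply: subset_closure; apply: NB.
Qed.

Lemma compositions_comp_compositions {T : Type} {A : set (T -> T)} {f g} :
  compositions A f -> compositions A g -> compositions A (f \o g).
Proof.
by move=> Af Ag; elim: Af => {f} // f1 f A1 _ IH; apply: (compositions_comp A1).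
Qed.

Lemma compositions_incl {T : Type} {A : set (T -> T)} {f} :
  A f -> compositions A f.
Proof. by move=> Af; apply: (compositions_comp Af (compositions_id A)). Qed.

(** * Extended operators and closed spans in the completion *)

Section Framework.
Variable F : framework.
Implicit Types (r t : Mbar F -> Mbar F) (Z N : set (Mbar F)).

(** An element of [Rbar] is given only as a continuous extension of an additive map. Its additivity
    defect [E] is continuous in each variable and vanishes on the image of [M]. As [{0}] is closed
    in a Hausdorff space, density gives [E = 0] everywhere, first in [x], then in [y]. *)
Lemma Rbar_additive {r} : @Rbar F r -> zmod_morphism r.
Proof.
move=> [cr [r' Rr' rE]].
have [iB hsd _ dns _] := Mbar_completion F.
have c0 : closed [set 0 : Mbar F].
  exact/accessible_closed_set1/hausdorff_accessible.
have cidf : continuous (fun x : Mbar F => x) by move=> ?; apply: cvg_id.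
have ccst (y : Mbar F) : continuous (fun _ : Mbar F => y).
  by move=> ?; apply: cvg_cst.
pose E x y := r (x - y) - (r x - r y).
have clE g h : continuous g -> continuous h ->
    closed [set x : Mbar F | [set 0] (E (g x) (h x))].
  move=> cg ch; apply: closed_preimage_diff => //.
    by move=> z; apply: continuous_comp; [apply: continuous_sub|apply: cr].
  by apply: continuous_sub => z; apply: continuous_comp;
    [apply: cg|apply: cr|apply: ch|apply: cr].
suff E0 x b : [set 0] (E x (iota F b)).
  move=> x y; apply: subr0_eq; move: y.
  apply: (closed_dense_setT _ [set y | [set 0] (E x y)] _ dns).
    exact: (clE _ _ (ccst x) cidf).
  by move=> _ [b _ <-]; apply: E0.
move: x; apply: (closed_dense_setT _ [set x | [set 0] (E x (iota F b))] _ dns).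
  exact: (clE _ _ cidf (ccst _)).
move=> _ [a _ <-] /=.
by rewrite /E -iB !rE (R_additive Rr') iB subrr.
Qed.

Lemma compositions_Rbar_additive {r} :
  compositions (@Rbar F) r -> zmod_morphism r.
Proof.
by elim=> // f g Rf _ gB x y; rewrite /= gB (Rbar_additive Rf).
Qed.

Lemma compositions_Rbar_iota {r} : compositions (@Rbar F) r ->
  exists2 r', compositions (R F) r' & forall a, r (iota F a) = iota F (r' a).
Proof.
elim=> [|f g [_ [f' Rf' fE]] _ [g' Rg' gE]]; first by exists idfun => //; left.
exists (f' \o g'); first exact: compositions_comp Rf' Rg'.
by move=> a /=; rewrite gE fE.
Qed.

Lemma RstarY_compositions {r m} :
  compositions (@Rbar F) r -> Y F m -> RstarY (r (iota F m)).
Proof.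
move=> /compositions_Rbar_iota[r' Rr' ->] Ym.
by exists (r' m) => //; exists r' => //; exists m.
Qed.

Lemma RstarY_iota m : Y F m -> RstarY (iota F m).
Proof. exact: (RstarY_compositions (compositions_id _)). Qed.

Lemma T1_compositions {t r} : T1 F t -> compositions (@Rbar F) r ->
  forall x, t (r x) = r (t x).
Proof.
move=> Tt; elim=> // f g Rf _ IH x /=.
by rewrite -IH -[LHS]/((t \o f) (g x)) (T1_commute Tt Rf).
Qed.

Lemma Span_Rmodule Z : is_Rmodule (@Rbar F) (Span Z).
Proof.
split; first split; first by move=> N [[[]]].
- move=> a b Sa Sb N HN; case: (HN) => -[[_ NB] _] _.
  by apply: NB; [apply: Sa|apply: Sb].
- move=> r a Rr Sa N HN; case: (HN) => -[_ NR] _.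
  by apply: NR => //; apply: Sa.
Qed.

Lemma Cspan_closed Z : closed (Cspan Z).
Proof. exact: closed_closure. Qed.

Lemma Cspan_subgroup Z : subgroup (Cspan Z).
Proof. exact: closure_subgroup (Span_Rmodule Z).1. Qed.

Lemma Cspan_incl Z : Z `<=` Cspan Z.
Proof.
by move=> z Zz; apply: subset_closure; apply: sub_gen_smallest.
Qed.

Lemma Cspan_Rbar {Z r a} : @Rbar F r -> Cspan Z a -> Cspan Z (r a).
Proof.
move=> Rr; suff : Cspan Z `<=` r @^-1` Cspan Z by apply.
rewrite [X in _ `<=` X](closure_id _).1; last first.
  by apply: closed_preimage; [case: Rr|apply: Cspan_closed].
apply: closureS => x Sx /=; apply: subset_closure.
exact: (Span_Rmodule Z).2.
Qed.

Lemma Cspan_compositions {Z r a} :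
  compositions (@Rbar F) r -> Cspan Z a -> Cspan Z (r a).
Proof. by move=> Rr Za; elim: Rr => // f g Rf _; apply: Cspan_Rbar. Qed.

(* [N] need not be an R-module: the largest R-module inside it,
   [{x | r x \in N for all r in R^*}], already contains [Z]. *)
Lemma Cspan_sub Z N : closed N -> subgroup N ->
  (forall r z, compositions (@Rbar F) r -> Z z -> N (r z)) -> Cspan Z `<=` N.
Proof.
move=> cN sN ZN; rewrite [X in _ `<=` X](closure_id _).1 //; apply: closureS.
pose N' := [set x | forall r, compositions (@Rbar F) r -> N (r x)].
suff : Span Z `<=` N' by move=> H x /H /(_ idfun (compositions_id _)).
apply: smallest_sub; last by move=> z Zz r Rr; apply: ZN.
split; first split.
- move=> r Rr; rewrite (zmod_morphism0 _ _ _ (compositions_Rbar_additive Rr)).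
  exact: sN.1.
- move=> a b Na Nb r Rr; rewrite (compositions_Rbar_additive Rr).
  by apply: sN.2; [apply: Na|apply: Nb].
- move=> r a Rr Na r' Rr'.
  exact: (Na _ (compositions_comp_compositions Rr' (compositions_incl Rr))).
Qed.

(** * Action of [T(S)] on [DSM], and congruences modulo [DIS] *)

Section Order.
Variable P : M F -> M F -> Prop.
Hypothesis P_order : partial_order_on_Y P.
Hypothesis P_compatible : compatible P.

Lemma DSM_sub (N : set (Mbar F)) m : closed N -> subgroup N ->
  (forall r n, compositions (@Rbar F) r -> Y F n -> strict P n m ->
     N (r (iota F n))) ->
  DSM P m `<=` N.
Proof.
by move=> cN sN H; apply: Cspan_sub => // r _ Rr [n [Yn nm] <-]; apply: H.
Qed.

Lemma DSM_iota n m : Y F n -> strict P n m -> DSM P m (iota F n).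
Proof. by move=> Yn nm; apply: Cspan_incl; exists n. Qed.

Lemma strict_trans a b c : Y F a -> Y F b -> Y F c ->
  strict P a b -> strict P b c -> strict P a c.
Proof.
case: P_order => _ anti trans Ya Yb Yc [Pab nab] [Pbc nbc].
split; first exact: trans Pbc.
by move=> ac; subst c; apply: nab; apply: anti.
Qed.

Lemma DSM_mono n m : Y F n -> Y F m -> strict P n m -> DSM P n `<=` DSM P m.
Proof.
move=> Yn Ym nm; apply: DSM_sub; [exact: Cspan_closed|exact: Cspan_subgroup|].
move=> r k Rr Yk kn; apply: Cspan_compositions Rr _.
by apply: DSM_iota => //; apply: (strict_trans k n m).
Qed.

(** Since [t] commutes with [R], only [t(n)] for [n < m] matters. By compatibility it is [n] itself
    or lies in [DSM(n)], which is contained in [DSM(m)] by transitivity. *)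
Lemma DSM_T1 {m t b} : Y F m -> T1 F t -> DSM P m b -> DSM P m (t b).
Proof.
move=> Ym Tt; suff : DSM P m `<=` t @^-1` DSM P m by apply.
apply: DSM_sub.
- by apply: closed_preimage; [apply: T1_continuous|apply: Cspan_closed].
- by apply: subgroup_preimage; [apply: T1_additive|apply: Cspan_subgroup].
move=> r n Rr Yn nm /=; rewrite (T1_compositions Tt Rr).
apply: Cspan_compositions Rr _.
case: (P_compatible t n Tt Yn) => [->|]; first exact: DSM_iota.
exact: (DSM_mono n).
Qed.

Lemma DSM_TS {m t b} : Y F m -> TS t -> DSM P m b -> DSM P m (t b).
Proof. by move=> Ym Tt Db; elim: Tt => // f g Tf _; apply: DSM_T1. Qed.

(** The first factor that moves [m] sends it into [DSM(m)] by compatibility, and the later factors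
    keep it there. *)
Lemma TS_site {m t} : Y F m -> TS t ->
  t (iota F m) = iota F m \/ DSM P m (t (iota F m)).
Proof.
move=> Ym; elim=> [|f g Tf _ [gm|Dg]]; first by left.
  by rewrite /= gm; apply: P_compatible.
by right; apply: (DSM_T1 Ym Tf).
Qed.

(** The map [x - t(x)] is continuous, additive and commutes with [R], and its values at the
    generators [n < m] of [DSM(m)] are generators of [DIS(m)]. *)
Lemma DIS_T1 {m t b} : T1 F t -> DSM P m b -> DIS P m (b - t b).
Proof.
move=> Tt; suff : DSM P m `<=` [set x | DIS P m (x - t x)] by apply.
apply: DSM_sub.
- apply: closed_preimage_diff; [|exact: T1_continuous|exact: Cspan_closed].
  by move=> ?; apply: cvg_id.
- by apply: subgroup_preimage_diff;
    [|apply: T1_additive|apply: Cspan_subgroup].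
move=> r n Rr Yn nm /=.
rewrite (T1_compositions Tt Rr) -(compositions_Rbar_additive Rr).
apply: Cspan_compositions Rr _; apply: Cspan_incl.
by exists n => //; exists t.
Qed.

Lemma DIS_trans {m a b c} :
  DIS P m (a - b) -> DIS P m (b - c) -> DIS P m (a - c).
Proof.
move=> ab bc; rewrite -(subrK b a) -addrA.
by apply: subgroup_add ab bc; apply: Cspan_subgroup.
Qed.

Lemma DIS_sym {m a b} : DIS P m (a - b) -> DIS P m (b - a).
Proof.
by rewrite -(opprB a b) => ab; apply: subgroup_opp ab; apply: Cspan_subgroup.
Qed.

(** Telescoping: [b - f(g(b))] is the sum of [b - g(b)] and [g(b) - f(g(b))], and [g(b)] is still in
    [DSM(m)]. *)
Lemma DIS_TS {m t b} : Y F m -> TS t -> DSM P m b -> DIS P m (b - t b).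
Proof.
move=> Ym Tt Db; elim: Tt => [|f g Tf Tg IH] /=.
  by rewrite subrr; apply: (Cspan_subgroup _).1.
by apply: (DIS_trans IH); apply: DIS_T1 => //; apply: DSM_TS.
Qed.

Lemma resolvable_swap (a : ambiguity F) :
  resolvable P (amb_swap a) -> resolvable P a.
Proof. exact: DIS_sym. Qed.

Lemma resolvable_equiv {a b : ambiguity F} :
  amb_equiv a b -> resolvable P b -> resolvable P a.
Proof. by case=> ->//; apply: resolvable_swap. Qed.

Lemma resolvable_equiv_sym {a b : ambiguity F} :
  amb_equiv a b -> resolvable P a -> resolvable P b.
Proof. by case=> ->//; apply: DIS_sym. Qed.

End Order.
End Framework.

(** * Images of [DIS] under maps, and resolution of montage ambiguities *)

Lemma DIS_image {Fj Fi : framework} {Pj : M Fj -> M Fj -> Prop}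
    {Pi : M Fi -> M Fi -> Prop} (v : Mbar Fj -> Mbar Fi) m n :
  partial_order_on_Y Pi -> compatible Pi ->
  advanceable v -> continuous v -> zmod_morphism v -> correlates Pj Pi v ->
  Y Fj m -> Y Fi n -> v (iota Fj m) = iota Fi n ->
  forall d, DIS Pj m d -> DIS Pi n (v d).
Proof.
move=> ordP compP av cv vB corv Ym Yn vm.
suff : DIS Pj m `<=` v @^-1` DIS Pi n by apply.
apply: Cspan_sub.
- by apply: closed_preimage => //; apply: Cspan_closed.
- by apply: subgroup_preimage => //; apply: Cspan_subgroup.
move=> r _ Rr [k [Yk km] [t Tt <-]] /=.
(* No commutation of [v] with [R] is available, so [r] is moved inside:
   [r(k - t(k)) = r(k) - t(r(k))] with [r(k)] in [R^*Y], where advanceability applies. *)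
rewrite (compositions_Rbar_additive _ Rr) -(T1_compositions _ Tt Rr) vB.
have [s Ts <-] := av _ _ Tt (RstarY_compositions _ Rr Yk).
apply: DIS_TS => //; apply: corv Ym Yn vm _ _.
exists (r (iota Fj k)) => //.
by apply: Cspan_compositions Rr _; apply: DSM_iota.
Qed.

Lemma resolvable_montage {F1 F2 F : framework} {P1 : M F1 -> M F1 -> Prop}
    {P2 : M F2 -> M F2 -> Prop} {P : M F -> M F -> Prop}
    (V1 : set (Mbar F1 -> Mbar F)) (V2 : set (Mbar F2 -> Mbar F))
    (a : ambiguity F) :
  partial_order_on_Y P1 -> partial_order_on_Y P2 -> partial_order_on_Y P ->
  compatible P1 -> compatible P2 -> compatible P ->
  (forall v, V1 v -> correlates P1 P v) ->
  (forall v, V2 v -> correlates P2 P v) ->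
  montage_triple V1 V2 a -> resolvable P a.
Proof.
move=> ord1 ord2 ord comp1 comp2 comp cor1 cor2.
move=> [l [t' [n [u' [w [[Yl Tt'] [Yn Tu'] [cw [[[wB1 wB2] adv] V1w V2w]]]]]]]].
rewrite /resolvable => aw; rewrite aw => -[ta ua]; rewrite ta ua.
have Ym := amb_site_Y a.
have := @amb_right_nontrivial _ a; have := @amb_left_nontrivial _ a.
rewrite aw ta ua.
set m := amb_site a in aw Ym *.
set x := iota F1 l; set y := iota F2 n => ntt ntu.
have cw1 z : continuous (fun b => w (b, z)).
  move=> b; apply: (@continuous_comp _ _ _ (fun b => (b, z)) w); last exact: cw.
  by apply: cvg_pair; [apply: cvg_id|apply: cvg_cst].
have cw2 z : continuous (fun c => w (z, c)).
  move=> c; apply: (@continuous_comp _ _ _ (fun c => (z, c)) w); last exact: cw.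
  by apply: cvg_pair; [apply: cvg_cst|apply: cvg_id].
have D1 b : DSM P1 l b -> DSM P m (w (b, y)).
  by move=> Db; apply: (cor1 _ (V1w _ Yn) l m Yl Ym) => //; exists b.
have D2 c : DSM P2 n c -> DSM P m (w (x, c)).
  by move=> Dc; apply: (cor2 _ (V2w _ Yl) n m Yn Ym) => //; exists c.
(* Nontriviality of the ambiguity rules out [t'(x) = x], since [w(t'(x), y)] differs from [w(x, y)];
   likewise for [u'] and [y]. *)
have Dt' : DSM P1 l (t' x).
  by case: (TS_site _ _ ord1 comp1 Yl Tt') => // t'x; case: ntt; rewrite t'x.
have Du' : DSM P2 n (u' y).
  by case: (TS_site _ _ ord2 comp2 Yn Tu') => // u'y; case: ntu; rewrite u'y.
(* Here all of [u'] is applied at once, since biadvanceability on the right covers [T(S)]. *)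
have right_step b : DSM P1 l b -> DIS P m (w (b, y) - w (b, u' y)).
  suff : DSM P1 l `<=` [set b | DIS P m (w (b, y) - w (b, u' y))] by apply.
  apply: DSM_sub.
  - by apply: closed_preimage_diff => //; apply: Cspan_closed.
  - by apply: subgroup_preimage_diff => //; apply: Cspan_subgroup.
  move=> r k Rr Yk kl /=.
  have [_ /(_ _ Tu')[s Ts <-]] :=
    adv _ _ (RstarY_compositions _ Rr Yk) (RstarY_iota _ _ Yn).
  apply: DIS_TS => //; apply: D1.
  by apply: Cspan_compositions Rr _; apply: DSM_iota.
have left_step f b : T1 F1 f -> DSM P1 l b -> DIS P m (w (b, y) - w (f b, y)).
  move=> Tf.
  suff : DSM P1 l `<=` [set b | DIS P m (w (b, y) - w (f b, y))] by apply.
  apply: DSM_sub.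
  - apply: closed_preimage_diff => //; last exact: Cspan_closed.
    move=> z; apply: (@continuous_comp _ _ _ f (fun b => w (b, y))).
      exact: T1_continuous.
    exact: cw1.
  - apply: subgroup_preimage_diff => //; last exact: Cspan_subgroup.
    by move=> b1 b2; rewrite (T1_additive Tf) wB1.
  move=> r k Rr Yk kl /=.
  have [/(_ _ Tf)[s Ts <-] _] :=
    adv _ _ (RstarY_compositions _ Rr Yk) (RstarY_iota _ _ Yn).
  apply: DIS_TS => //; apply: D1.
  by apply: Cspan_compositions Rr _; apply: DSM_iota.
(* Here [x] itself is not in [DSM(l)]; smallness comes instead from the second argument, as [u'(y)]
   lies in [DSM(n)]. *)
have first_step f : T1 F1 f -> DIS P m (w (x, u' y) - w (f x, u' y)).
  move=> Tf.
  suff : DSM P2 n `<=` [set c | DIS P m (w (x, c) - w (f x, c))] by apply.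
  apply: DSM_sub.
  - by apply: closed_preimage_diff => //; apply: Cspan_closed.
  - by apply: subgroup_preimage_diff => //; apply: Cspan_subgroup.
  move=> r k Rr Yk kl /=.
  have [/(_ _ Tf)[s Ts <-] _] :=
    adv _ _ (RstarY_iota _ _ Yl) (RstarY_compositions _ Rr Yk).
  apply: DIS_TS => //; apply: D2.
  by apply: Cspan_compositions Rr _; apply: DSM_iota.
(* Biadvanceability on the left only covers T1, so t' is peeled off one factor
   at a time; the first factor moving x lands in DSM, where both steps apply. *)
have key s : TS s ->
    s x = x \/ DSM P1 l (s x) /\ DIS P m (w (s x, y) - w (x, u' y)).
  elim=> [|f g Tf Tg [gx|[Dg IH]]]; first by left.
    rewrite /= gx; case: (comp1 f l Tf Yl) => [->|Dfx]; first by left.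
    right; split=> //.
    (* If [f] is the first factor to move [x], then [w(f(x), y)], [w(f(x), u'(y))] and [w(x, u'(y))]
       are successively congruent. *)
    apply: (DIS_trans _ _ (right_step _ Dfx)).
    by apply/DIS_sym/first_step.
  right; split; first exact: (DSM_T1 _ _ ord1 comp1 Yl Tf).
  by apply: (DIS_trans _ _ _ IH); apply/DIS_sym/left_step.
case: (key t' Tt') => [t'x|[]//].
by case: ntt; rewrite t'x.
Qed.

(** * Reduction of all ambiguities to the critical ones *)

Theorem theorem6p9 (I : Type) (F : I -> framework)
  (V : forall i j : I, set (Mbar (F j) -> Mbar (F i)))
  (V_advanceable : forall (i j : I) (v : Mbar (F j) -> Mbar (F i)), V i j v ->
     [/\ advanceable v, continuous v & zmod_morphism v])
  (P : forall i : I, M (F i) -> M (F i) -> Prop)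
  (P_order : forall i : I, partial_order_on_Y (P i))
  (T1_compatible : forall i : I, compatible (P i))
  (V_correlates : forall (i j : I) (v : Mbar (F j) -> Mbar (F i)), V i j v ->
     correlates (P j) (P i) v) :
  (forall (i : I) (a : ambiguity (F i)), resolvable (P i) a) <->
  (forall (i : I) (a : ambiguity (F i)), critical V a -> resolvable (P i) a).
Proof.
split=> [H i a _ //|critP].
have montageP i i1 i2 (a : ambiguity (F i)) :
    montage (V i i1) (V i i2) a -> resolvable (P i) a.
  move=> [a0 aa0 ma0]; apply: resolvable_equiv aa0 _.
  apply: (resolvable_montage (V i i1) (V i i2)) ma0 => //;
    exact: V_correlates.
have criticalP i (a : ambiguity (F i)) :
    shadow_critical V a -> resolvable (P i) a.
  move=> sca; have [[i1 [i2 /montageP//]]|nm] :=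
    pselect (exists i1 i2, montage (V i i1) (V i i2) a).
  by apply: critP; split=> // i1 i2 ma; apply: nm; exists i1, i2.
move=> i a; have [/criticalP//|] := pselect (shadow_critical V a).
move=> /existsNP[i' /existsNP[a' /not_implyP[mina' /contrapT[sh _]]]].
(* A shadow-minimal ambiguity is a proper shadow of nothing, in particular of no shadow-minimal one,
   so it is shadow-critical. *)
have resa' : resolvable (P i') a' by apply: criticalP => j b _; apply: mina'.
case: sh => a0 [a0' [aa0 aa0' [v Vv [site lft rgt]]]].
apply: (resolvable_equiv _ _ aa0).
have [adv cv vB] := V_advanceable _ _ _ Vv.
(* For the representatives matched by [v], the difference to resolve is the image under [v] of the
   difference for [a0']. *)
rewrite /resolvable lft rgt -vB.
apply: (DIS_image _ (amb_site a0')) => //; first exact: V_correlates.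
- exact: amb_site_Y.
- exact: amb_site_Y.
- exact: resolvable_equiv_sym aa0' resa'.
Qed.
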